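(* Let $t\ge 1$ be an integer and let $u=x_{i_1}\cdots x_{i_d}$ be a $t$-spread monomial in $S=K[x_1,\dots,x_n]$. Then the $t$-spread principal Borel ideal $B_t(u)$ satisfies the $\ell$-exchange property with respect to the sorting order $<_{\mathrm{sort}}$.
   Context: $K$ is a field, $S=K[x_1,\dots,x_n]$. For a monomial $w$, $\operatorname{supp}(w)=\{j: x_j\mid w\}$ and $\deg_{x_i}(w)$ is the exponent of $x_i$ in $w$; for a monomial ideal $I$, $G(I)$ denotes its unique minimal set of monomial generators. For an integer $t\ge 1$, a monomial $x_{i_1}\cdots x_{i_d}\in S$ with $i_1\le\cdots\le i_d$ is called $t$-spread if $i_j-i_{j-1}\ge t$ for $2\le j\le d$. A $t$-spread monomial ideal is an ideal generated by $t$-spread monomials. A $t$-spread monomial ideal $I$ is $t$-spread strongly stable if for all $w\in G(I)$, $j\in\operatorname{supp}(w)$ and $i<j$ such that $x_i(w/x_j)$ is $t$-spread, one has $x_i(w/x_j)\in I$. For a $t$-spread monomial $u=x_{i_1}\cdots x_{i_d}$, $B_t(u)$ denotes the smallest $t$-spread strongly stable ideal containing $u$ (the $t$-spread principal Borel ideal of $u$). Explicitly, $G(B_t(u))$ consists of the monomials $x_{j_1}\cdots x_{j_d}$ with $j_k\le i_k$ for $1\le k\le d$ and $j_k-j_{k-1}\ge t$ for $2\le k\le d$. Sorting. For monomials $v,w\in S$ of degree $d$, write $vw=x_{a_1}x_{a_2}\cdots x_{a_{2d}}$ with $a_1\le\cdots\le a_{2d}$ and put $\operatorname{sort}(v,w)=(v',w')$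 with $v'=x_{a_1}x_{a_3}\cdots x_{a_{2d-1}}$, $w'=x_{a_2}x_{a_4}\cdots x_{a_{2d}}$. The pair $(v,w)$ is sorted if $\operatorname{sort}(v,w)=(v,w)$. It is known that if $v,w\in G(B_t(u))$ then $v',w'\in G(B_t(u))$. Sorting order. Let $I=B_t(u)$, $T=K[\{t_v: v\in G(I)\}]$ and let $P$ be the kernel of the $K$-algebra homomorphism $T\to K[G(I)]$, $t_v\mapsto v$, where $K[G(I)]\subset S$ is the subalgebra generated by $G(I)$. The sorting order $<_{\mathrm{sort}}$ is a monomial order on $T$ for which the nonzero binomials $t_vt_w-t_{v'}t_{w'}$ with $v,w\in G(I)$, $(v',w')=\operatorname{sort}(v,w)$ (the pairs for which neither $(v,w)$ nor $(w,v)$ is sorted) form a Gröbner basis of $P$ with initial monomials $t_vt_w$ (such orders are known to exist). $\ell$-exchange property. Let $I\subset S$ be a monomial ideal generated in a single degree, $T=K[\{t_v:v\in G(I)\}]$ with a monomial order $<$, and $P$ the kernel of $T\to K[G(I)]$, $t_v\mapsto v$. A monomial $t_{u_1}\cdots t_{u_N}$ of $T$ is standard with respect to $<$ if it does not belong to the initial ideal $\operatorname{in}_<(P)$. The ideal $I$ satisfies the $\ell$-exchange property with respect to $<$ if the following holds: whenever $t_{u_1}\cdots t_{u_N}$ and $t_{v_1}\cdots t_{v_N}$ are standard monomials with respect to $<$ of the same degree $N$ satisfying (i) $\deg_{x_i}(u_1\cdots u_N)=\deg_{x_i}(v_1\cdots v_N)$ for $1\le i\le q-1$ with $q\le n-1$,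 and (ii) $\deg_{x_q}(u_1\cdots u_N)<\deg_{x_q}(v_1\cdots v_N)$, there exist integers $\delta\in\{1,\dots,N\}$ and $j$ with $q<j\le n$ and $j\in\operatorname{supp}(u_\delta)$ such that $x_qu_\delta/x_j\in I$. *)

(* Defs.v *)
From mathcomp Require Import all_boot all_order all_algebra.
From mathcomp Require Import mpoly.

Set Implicit Arguments.
Unset Strict Implicit.
Unset Printing Implicit Defensive.

Import GRing.Theory.
Local Open Scope ring_scope.

(* A monomial of K[x_1, ..., x_n] is its exponent vector m : 'X_{1..n}, so the
   product of monomials is (m1 + m2)%MM and divisibility is (m1 <= m2)%MM; as a
   polynomial it is 'X_[m]. Variables are numbered from 0: x_i is 'X_(i-1). *)

(* Prop-valued, and not ring_quotient's idealr_closed: the latter excludes the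
   unit ideal. *)
Definition is_ideal (K : fieldType) (n : nat) (I : {mpoly K[n]} -> Prop) : Prop :=
  [/\ I 0,
      forall p q, I p -> I q -> I (p + q)
    & forall p q, I q -> I (p * q)].

Definition ideal_gen (K : fieldType) (n : nat) (A : {mpoly K[n]} -> Prop)
    (p : {mpoly K[n]}) : Prop :=
  forall J, is_ideal J -> (forall q, A q -> J q) -> J p.

Definition monomial_ideal_gen (K : fieldType) (n : nat) (M : 'X_{1..n} -> Prop) :
    {mpoly K[n]} -> Prop :=
  ideal_gen (fun p => exists2 m, M m & p = 'X_[m]).

Definition generated_by (K : fieldType) (n : nat) (I : {mpoly K[n]} -> Prop)
    (M : 'X_{1..n} -> Prop) : Prop :=
  forall p, I p <-> monomial_ideal_gen M p.

Definition minimal_generating_set (K : fieldType) (n : nat)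
    (I : {mpoly K[n]} -> Prop) (M : 'X_{1..n} -> Prop) : Prop :=
  generated_by I M /\
  forall M' : 'X_{1..n} -> Prop,
    (forall m, M' m -> M m) -> generated_by I M' -> forall m, M m -> M' m.

(* G(I), for a monomial ideal I: such an I has exactly one minimal set of
   monomial generators. *)
Definition mingens (K : fieldType) (n : nat) (I : {mpoly K[n]} -> Prop)
    (m : 'X_{1..n}) : Prop :=
  exists2 M, minimal_generating_set I M & M m.

(* The factorization m = x_{i_1} ... x_{i_d}, i_1 <= ... <= i_d, as the sequence
   of indices i_1, ..., i_d. *)
Definition mnm_vars (n : nat) (m : 'X_{1..n}) : seq 'I_n :=
  flatten [seq nseq (m i) i | i <- enum 'I_n].

Definition t_spread (t n : nat) (m : 'X_{1..n}) : bool :=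
  sorted (fun i j : 'I_n => (i + t <= j)%N) (mnm_vars m).

(* x_i (w / x_j); only meaningful when x_j divides w. *)
Definition mnm_exchange (n : nat) (w : 'X_{1..n}) (i j : 'I_n) : 'X_{1..n} :=
  (U_(i) + (w - U_(j)))%MM.

Definition t_spread_ideal (K : fieldType) (t n : nat)
    (I : {mpoly K[n]} -> Prop) : Prop :=
  exists2 M : 'X_{1..n} -> Prop, (forall m, M m -> t_spread t m) & generated_by I M.

Definition t_spread_strongly_stable (K : fieldType) (t n : nat)
    (I : {mpoly K[n]} -> Prop) : Prop :=
  t_spread_ideal t I /\
  forall (w : 'X_{1..n}) (i j : 'I_n),
    mingens I w -> (0 < w j)%N -> (i < j)%N ->
    t_spread t (mnm_exchange w i j) -> I 'X_[mnm_exchange w i j].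

(* B_t(u), the smallest t-spread strongly stable ideal containing u, realized
   as the intersection of all of them. *)
Definition t_spread_borel (K : fieldType) (t n : nat) (u : 'X_{1..n})
    (p : {mpoly K[n]}) : Prop :=
  forall J : {mpoly K[n]} -> Prop,
    t_spread_strongly_stable t J -> J 'X_[u] -> J p.

(* T = K[t_v : v in G(I)] is {mpoly K[r]} for a listing g : r.-tuple 'X_{1..n}
   of G(I): the variable 'X_a of T is t_v for v = tnth g a. *)
Definition enumerates_mingens (K : fieldType) (n r : nat)
    (I : {mpoly K[n]} -> Prop) (g : r.-tuple 'X_{1..n}) : Prop :=
  uniq g /\ forall m, m \in g <-> mingens I m.

Definition toric_ideal (K : fieldType) (n r : nat) (g : r.-tuple 'X_{1..n})
    (p : {mpoly K[r]}) : Prop :=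
  p \mPo [tuple 'X_[K, tnth g a] | a < r] = 0.

Definition monomial_order (r : nat) (le : rel 'X_{1..r}) : Prop :=
  [/\ total le, antisymmetric le, transitive le,
      forall a, le 0%MM a
    & forall a b c, le a b -> le (a + c)%MM (b + c)%MM].

Definition initial_monomial (K : fieldType) (r : nat) (le : rel 'X_{1..r})
    (p : {mpoly K[r]}) (m : 'X_{1..r}) : Prop :=
  m \in msupp p /\ forall m', m' \in msupp p -> le m' m.

(* The ideal generated by the initial monomials of the nonzero elements of F
   (the zero polynomial has no initial monomial). *)
Definition initial_ideal (K : fieldType) (r : nat) (le : rel 'X_{1..r})
    (F : {mpoly K[r]} -> Prop) : {mpoly K[r]} -> Prop :=
  monomial_ideal_gen (fun m => exists2 f, F f & initial_monomial le f m).

Definition groebner_basis (K : fieldType) (r : nat) (le : rel 'X_{1..r})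
    (F P : {mpoly K[r]} -> Prop) : Prop :=
  (forall f, F f -> P f /\ f != 0) /\
  forall p, initial_ideal le P p <-> initial_ideal le F p.

Definition standard_monomial (K : fieldType) (r : nat) (le : rel 'X_{1..r})
    (P : {mpoly K[r]} -> Prop) (m : 'X_{1..r}) : Prop :=
  ~ initial_ideal le P 'X_[m].

(* With positions counted from 0, a_1, a_3, ... sit at the even positions. *)
Definition mnm_sort (n : nat) (v w : 'X_{1..n}) : 'X_{1..n} * 'X_{1..n} :=
  let s := mnm_vars (v + w)%MM in
  ((\sum_(k < size s | ~~ odd k) U_(tnth (in_tuple s) k))%MM,
   (\sum_(k < size s | odd k) U_(tnth (in_tuple s) k))%MM).

(* f = t_v t_w - t_v' t_w' with v = tnth g a, w = tnth g b, sort(v,w) = (v',w'). *)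
Definition sorting_relation (K : fieldType) (n r : nat) (g : r.-tuple 'X_{1..n})
    (a b : 'I_r) (f : {mpoly K[r]}) : Prop :=
  exists a' b' : 'I_r,
    mnm_sort (tnth g a) (tnth g b) = (tnth g a', tnth g b')
    /\ f = 'X_a * 'X_b - 'X_a' * 'X_b'.

Definition sorting_order (K : fieldType) (n r : nat) (g : r.-tuple 'X_{1..n})
    (le : rel 'X_{1..r}) : Prop :=
  [/\ monomial_order le,
      groebner_basis le
        (fun f : {mpoly K[r]} =>
           f != 0 /\ exists a b : 'I_r, sorting_relation g a b f)
        (toric_ideal g)
    & forall (a b : 'I_r) (f : {mpoly K[r]}),
        sorting_relation g a b f -> f != 0 ->
        initial_monomial le f (U_(a) + U_(b))%MM].

(* The monomials t_{u_1} ... t_{u_N} and t_{v_1} ... t_{v_N} of T are given by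
   their indices us, vs in the listing g of G(I). With x_q numbered from 0, the
   condition q <= n - 1 reads q.+1 < n. *)
Definition l_exchange (K : fieldType) (n r : nat) (I : {mpoly K[n]} -> Prop)
    (g : r.-tuple 'X_{1..n}) (le : rel 'X_{1..r}) : Prop :=
  forall (N : nat) (us vs : N.-tuple 'I_r) (q : 'I_n),
    standard_monomial le (@toric_ideal K n r g) (\sum_(k < N) U_(tnth us k))%MM ->
    standard_monomial le (@toric_ideal K n r g) (\sum_(k < N) U_(tnth vs k))%MM ->
    (q.+1 < n)%N ->
    (forall i : 'I_n, (i < q)%N ->
       (\sum_(k < N) tnth g (tnth us k))%MM i
       = (\sum_(k < N) tnth g (tnth vs k))%MM i) ->
    ((\sum_(k < N) tnth g (tnth us k))%MM q
       < (\sum_(k < N) tnth g (tnth vs k))%MM q)%N ->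
    exists (delta : 'I_N) (j : 'I_n),
      [/\ (q < j)%N,
          (0 < tnth g (tnth us delta) j)%N
        & I 'X_[mnm_exchange (tnth g (tnth us delta)) q j]].

(* Main.v *)
(* Encode a monomial m by its cumulative degrees F_m(c) = sum of the exponents of
   the variables of index < c. Then m is t-spread iff F_m(c + t) <= F_m(c) + 1
   for all c, G(B_t(u)) consists of the t-spread m of degree deg u with
   F_u <= F_m, and sort(v, w) has cumulative degrees ceil((F_v + F_w) / 2) and
   floor((F_v + F_w) / 2). Hence the factors u_1, ..., u_N of a standard monomial
   have cumulative degrees which differ pairwise by at most 1 at each c.
   If F_w(q+1) = F_w(q+1-t) < deg w, then x_j, the first variable after x_q
   dividing w, can be exchanged for x_q. With c0 = q+1-t, suppose no u_k allows
   this. If F_{u_k}(c0) = d for some k, closeness forces F_{u_k}(q+1) = d for all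
   k; otherwise F_{u_k}(q+1) > F_{u_k}(c0) for all k. As the v_k are t-spread and
   the sums over k agree at c0 <= q, either way the sum of F_{u_k}(q+1) is at
   least that of F_{v_k}(q+1), contradicting (ii). *)

Require Import Defs.
From mathcomp Require Import all_boot all_order all_algebra.
From mathcomp Require Import mpoly.
From mathcomp Require Import zify.
From Stdlib Require Import Classical.

(** * Cumulative degrees of monomials *)

Definition cumdeg {n} (m : 'X_{1..n}) (c : nat) : nat := \sum_(i < n | i < c) m i.

Lemma cumdegD n (m1 m2 : 'X_{1..n}) c :
  cumdeg (m1 + m2)%MM c = cumdeg m1 c + cumdeg m2 c.
Proof. by rewrite -big_split; apply: eq_bigr => i _; rewrite mnmDE. Qed.

Lemma cumdeg_sum n (I : Type) (s : seq I) (P : pred I) (F : I -> 'X_{1..n}) c :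
  cumdeg (\sum_(i <- s | P i) F i)%MM c = \sum_(i <- s | P i) cumdeg (F i) c.
Proof.
rewrite exchange_big /=; apply: eq_bigr => i _.
by rewrite mnm_sumE.
Qed.

Lemma cumdeg1 n (i : 'I_n) c : cumdeg U_(i)%MM c = (i < c).
Proof.
rewrite /cumdeg (eq_bigr (fun j => (i == j) : nat)) => [|j _]; last exact: mnm1E.
rewrite big_mkcond (bigD1 i) //= eqxx big1 ?addn0 => [|j /negbTE ji].
  by case: ifP.
by rewrite eq_sym ji if_same.
Qed.

Lemma cumdeg0 n (m : 'X_{1..n}) : cumdeg m 0 = 0.
Proof. by rewrite /cumdeg big_pred0. Qed.

Lemma cumdegS n (m : 'X_{1..n}) (i : 'I_n) : cumdeg m i.+1 = cumdeg m i + m i.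
Proof.
rewrite /cumdeg (bigD1 i) //= addnC; congr (_ + _).
by apply: eq_bigl => j; rewrite ltnS andbC -ltn_neqAle.
Qed.

Lemma leq_cumdeg n (m : 'X_{1..n}) c1 c2 : c1 <= c2 -> cumdeg m c1 <= cumdeg m c2.
Proof.
move=> le_c; rewrite /cumdeg [X in _ <= X](bigID (fun i : 'I_n => i < c1)) /=.
rewrite (eq_bigl (fun i : 'I_n => (i < c2) && (i < c1))) ?leq_addr // => i.
by lia.
Qed.

Lemma cumdeg_mdeg n (m : 'X_{1..n}) c : n <= c -> cumdeg m c = mdeg m.
Proof.
move=> le_nc; rewrite mdegE; apply: eq_bigl => i.
exact: leq_trans (ltn_ord i) le_nc.
Qed.

Lemma cumdeg_le_mdeg n (m : 'X_{1..n}) c : cumdeg m c <= mdeg m.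
Proof. by rewrite mdegE /cumdeg big_mkcond leq_sum // => i _; case: ifP. Qed.

Lemma cumdeg_inj n (m1 m2 : 'X_{1..n}) : cumdeg m1 =1 cumdeg m2 -> m1 = m2.
Proof.
by move=> eqF; apply/mnmP => i; have := eqF i.+1; rewrite !cumdegS eqF; lia.
Qed.

(** Compares the degrees in the variables with index in [c1, c2), written additively to avoid
    truncated subtraction. *)
Lemma lep_cumdeg n (m1 m2 : 'X_{1..n}) c1 c2 : (m1 <= m2)%MM -> c1 <= c2 ->
  cumdeg m1 c2 + cumdeg m2 c1 <= cumdeg m2 c2 + cumdeg m1 c1.
Proof.
move=> /submK <- le_c; rewrite !cumdegD; have := leq_cumdeg _ (m2 - m1)%MM _ _ le_c.
lia.
Qed.

Lemma cumdeg_exchange n (w : 'X_{1..n}) (i j : 'I_n) c : 0 < w j ->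
  cumdeg (mnm_exchange w i j) c + (j < c) = cumdeg w c + (i < c).
Proof.
move=> wj; have le1w : (U_(j) <= w)%MM by rewrite lep1mP -lt0n.
by rewrite -{2}(submK le1w) /mnm_exchange !cumdegD !cumdeg1; lia.
Qed.

Lemma mdeg_exchange n (w : 'X_{1..n}) (i j : 'I_n) : 0 < w j ->
  mdeg (mnm_exchange w i j) = mdeg w.
Proof.
move=> wj; have := cumdeg_exchange n w i j n wj.
by rewrite !cumdeg_mdeg // !ltn_ord; lia.
Qed.

(** * Spreadness, sorting and exchanges in terms of cumulative degrees *)

Lemma count_mnm_vars n (m : 'X_{1..n}) (P : pred 'I_n) :
  count P (mnm_vars m) = \sum_(i < n | P i) m i.
Proof.
rewrite /mnm_vars count_flatten -map_comp sumnE big_map big_enum [RHS]big_mkcond /=.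
by apply: eq_bigr => i _; rewrite count_nseq; case: (P i); rewrite ?mul1n.
Qed.

Lemma count_mnm_vars_window n (m : 'X_{1..n}) c1 c2 : c1 <= c2 ->
  cumdeg m c1 + count (fun i : 'I_n => c1 <= i < c2) (mnm_vars m) = cumdeg m c2.
Proof.
move=> le_c; rewrite count_mnm_vars /cumdeg.
rewrite [RHS](bigID (fun i : 'I_n => i < c1)) /=; congr (_ + _); apply: eq_bigl => i.
  by lia.
by lia.
Qed.

Lemma mnm_vars_pairwise n (m : 'X_{1..n}) :
  pairwise (fun i j : 'I_n => i <= j) (mnm_vars m).
Proof.
have: pairwise (fun i j : 'I_n => i < j) (enum 'I_n).
  rewrite -(pairwise_map (val : 'I_n -> nat) ltn) val_enum_ord.
  by rewrite -sorted_pairwise ?iota_ltn_sorted //; apply: ltn_trans.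
rewrite /mnm_vars; elim: (enum _) => //= i s IHs /andP[/allP lt_is /IHs sorted_s].
rewrite pairwise_cat sorted_s andbT; apply/andP; split.
  apply/allrelP => x y /nseqP[-> _] /flatten_mapP[j /lt_is lt_ij /nseqP[-> _]].
  exact: ltnW.
by elim: (m i) => //= k IHk; rewrite IHk all_nseq leqnn orbT.
Qed.

(** The gap relation is transitive, so it may be tested on all pairs; a pair violates it exactly
    when both entries lie in one window of [t] consecutive indices. *)
Lemma t_spreadP t n (m : 'X_{1..n}) : 0 < t ->
  reflect (forall c, cumdeg m (c + t) <= (cumdeg m c).+1) (t_spread t m).
Proof.
move=> t_gt0; rewrite /t_spread sorted_pairwise; last by move=> ? ? ?; lia.
apply: (iffP idP) => [spread c | spread].
  rewrite -(count_mnm_vars_window _ _ c) ?leq_addr // -addn1 leq_add2l.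
  rewrite -size_filter; have := pairwise_filter (fun i : 'I_n => c <= i < c + t) spread.
  have := filter_all (fun i : 'I_n => c <= i < c + t) (mnm_vars m).
  by case: filter => [|x [|y s]] //= /and3P[? ? _] /andP[/andP[]]; lia.
have win c : count (fun i : 'I_n => c <= i < c + t) (mnm_vars m) <= 1.
  by have := count_mnm_vars_window _ m _ _ (leq_addr t c); have := spread c; lia.
elim: (mnm_vars m) (mnm_vars_pairwise _ m) win => //= x s IHs.
move=> /andP[/allP le_xs sorted_s] win; rewrite IHs ?andbT //; last first.
  by move=> c; have := win c; lia.
apply/allP => y ys; rewrite leqNgt; apply/negP => lt_yx.
have := win x; have -> /= : x <= x < x + t by lia.
have : has (fun i : 'I_n => x <= i < x + t) s.
  by apply/hasP; exists y => //; have := le_xs _ ys; lia.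
by rewrite has_count; lia.
Qed.

(* The hypothesis says that a holds on an initial segment of s. *)
Lemma sorted_parity_count (T : eqType) (a : pred T) (x0 : T) (s : seq T) :
  pairwise (fun x y => a y ==> a x) s ->
  \sum_(k < size s | ~~ odd k) a (nth x0 s k) = uphalf (count a s)
  /\ \sum_(k < size s | odd k) a (nth x0 s k) = (count a s)./2.
Proof.
elim: s => [|x s IHs] /=; first by rewrite !big_ord0.
move=> /andP[/allP ax /IHs[IHe IHo]].
(* Removing the head shifts all positions by one and so interchanges the two parities. *)
rewrite big_mkcond [X in _ /\ X = _]big_mkcond !big_ord_recl /= add0n.
rewrite -!big_mkcond /= (eq_bigl (fun k : 'I_(size s) => odd k)) => [|k]; last first.
  by rewrite negbK.
rewrite IHe IHo; have := ax; case: (a x) => /= {}ax; first by split; lia.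
suff -> : count a s = 0 by [].
by apply/eqP; rewrite -leqn0 leqNgt -has_count; apply/hasPn => y /ax; rewrite implybF.
Qed.

(** The indices below [c] form an initial segment of the sorted list of [v + w]; when its length is
    odd, the extra entry sits at an even position and goes to the first component. *)
Lemma cumdeg_sort n (v w : 'X_{1..n}) c :
  cumdeg (mnm_sort v w).1 c = uphalf (cumdeg v c + cumdeg w c)
  /\ cumdeg (mnm_sort v w).2 c = (cumdeg v c + cumdeg w c)./2.
Proof.
have def_s : count (fun i : 'I_n => i < c) (mnm_vars (v + w)%MM)
           = cumdeg v c + cumdeg w c by rewrite count_mnm_vars -cumdegD.
rewrite /mnm_sort /= !cumdeg_sum -def_s.
have := mnm_vars_pairwise _ (v + w)%MM.
case: (mnm_vars _) => [|x0 s] sorted_s; first by rewrite !big_ord0.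
have sorted_a : pairwise (fun x y : 'I_n => (y < c) ==> (x < c)) (x0 :: s).
  by apply: sub_pairwise sorted_s => x y; lia.
have [<- <-] := sorted_parity_count _ _ x0 _ sorted_a.
by split; apply: eq_bigr => k _; rewrite cumdeg1 (tnth_nth x0).
Qed.

Lemma t_spread_lep t n (m1 m2 : 'X_{1..n}) : 0 < t -> (m1 <= m2)%MM ->
  t_spread t m2 -> t_spread t m1.
Proof.
move=> t_gt0 le_m /t_spreadP spread; apply/t_spreadP => // c.
have := spread t_gt0 c; have := lep_cumdeg _ _ _ _ _ le_m (leq_addr t c); lia.
Qed.

(** Moving the first variable x_j after x_q down to x_q raises F_w by 1 exactly for q < c <= j.
    Spreadness is thus at risk only if c <= q < c + t <= j, and there F_w(c + t) <= F_w(q+1) <=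
    F_w(q+1-t) <= F_w(c). *)
Lemma t_spread_exchange t n (w : 'X_{1..n}) (q : 'I_n) : 0 < t -> t_spread t w ->
  cumdeg w q.+1 <= cumdeg w (q.+1 - t) -> cumdeg w q.+1 < mdeg w ->
  exists j : 'I_n, [/\ q < j, 0 < w j, cumdeg w j = cumdeg w q.+1
                     & t_spread t (mnm_exchange w q j)].
Proof.
move=> t_gt0 /t_spreadP spread gap lt_deg.
have ex_j : exists c, cumdeg w q.+1 < cumdeg w c.
  by exists n; rewrite (cumdeg_mdeg _ _ n).
(* The least such [c] is the successor of the wanted index: F_w jumps there because x_j divides
   [w]. *)
case: (ex_minnP ex_j) => [[|j]]; first by rewrite cumdeg0.
move=> lt_j min_j.
have lt_jn : j < n by apply: min_j; rewrite (cumdeg_mdeg _ _ n).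
have lt_qj : q < j.
  by rewrite ltnNge; apply/negP => le_jq; have := leq_cumdeg _ w j.+1 q.+1; lia.
have cum_j : cumdeg w j = cumdeg w q.+1.
  apply/eqP; rewrite eqn_leq (leq_cumdeg _ _ q.+1) // andbT leqNgt; apply/negP => /min_j.
  by rewrite ltnn.
have w_j : 0 < w (Ordinal lt_jn) by have := cumdegS _ w (Ordinal lt_jn); rewrite /=; lia.
exists (Ordinal lt_jn); split=> //; apply/t_spreadP => // c.
have := cumdeg_exchange _ w q (Ordinal lt_jn) (c + t) w_j.
have := cumdeg_exchange _ w q (Ordinal lt_jn) c w_j.
have := spread t_gt0 c; rewrite /=.
have [lt_qc|le_cq] := ltnP q c; first by lia.
have [lt_jct|le_ctj] := ltnP j (c + t); first by lia.
have [lt_qct|le_ctq] := ltnP q (c + t); last by lia.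
have := leq_cumdeg _ w _ _ le_ctj; have := leq_cumdeg _ w (q.+1 - t) c.
lia.
Qed.

(** * Monomial ideals and their minimal generators *)

Section MonomialIdeals.
Variables (K : fieldType) (n : nat).
Implicit Types (I J : {mpoly K[n]} -> Prop) (M : 'X_{1..n} -> Prop).
Import GRing.Theory.
Local Open Scope ring_scope.

Lemma monomial_ideal_genP M p :
  @monomial_ideal_gen K n M p <->
  (forall m, m \in msupp p -> exists2 m', M m' & (m' <= m)%MM).
Proof.
split=> [genp | suppM].
  (* The polynomials satisfying the support condition form an ideal containing the generators. *)
  apply: (genp (fun p : {mpoly K[n]} => forall m, m \in msupp p ->
    exists2 m', M m' & (m' <= m)%MM)); last first.
    move=> _ [m Mm ->] m'; rewrite msuppX inE => /eqP->.
    by exists m => //; apply: lepm_refl.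
  split=> [m | {genp}p q IHp IHq m /msuppD_le | {genp}p q IHq m /msuppM_le].
  - by rewrite msupp0.
  - by rewrite mem_cat => /orP[/IHp|/IHq].
  - case/allpairsP => -[m1 m2] /= [_ /IHq[m' Mm' le_m'] ->].
    by exists m' => //; apply: lepm_trans le_m' (lem_addl _ _).
move=> J [J0 JD JM] JX; rewrite (mpolyE p).
rewrite big_seq; elim/big_ind: _ => //= m /suppM[m' Mm' /submK <-].
rewrite -mul_mpolyC mpolyXD mulrA; apply: JM; apply: JX.
by exists m'.
Qed.

Lemma monomial_ideal_genX M m :
  monomial_ideal_gen M ('X_[m] : {mpoly K[n]}) <-> exists2 m', M m' & (m' <= m)%MM.
Proof.
rewrite monomial_ideal_genP; split=> [|le_m m']; first by apply; rewrite msuppX inE.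
by rewrite msuppX inE => /eqP->.
Qed.

Lemma monomial_ideal_gen_ideal M : is_ideal (@monomial_ideal_gen K n M).
Proof.
split=> [J [] //|p q Ip Iq J JI JM|p q Iq J JI JM]; case: (JI) => _ JD JM'.
  by apply: JD; [apply: Ip | apply: Iq].
by apply: JM'; apply: Iq.
Qed.

Lemma generated_byX I M m : generated_by I M ->
  I 'X_[m] <-> exists2 m', M m' & (m' <= m)%MM.
Proof. by move=> genI; rewrite genI monomial_ideal_genX. Qed.

Lemma generated_by_lepm I M m1 m2 : generated_by I M ->
  I 'X_[m1] -> (m1 <= m2)%MM -> I 'X_[m2].
Proof.
move=> genI; rewrite !(generated_byX _ _ _ genI) => -[m Mm le_m] le12.
by exists m => //; apply: lepm_trans le_m le12.
Qed.

Lemma generated_by_sub I M M' : generated_by I M ->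
  (forall m, M' m -> I 'X_[m]) ->
  (forall m, M m -> exists2 m', M' m' & (m' <= m)%MM) -> generated_by I M'.
Proof.
move=> genI subM' subM p; rewrite genI !monomial_ideal_genP.
split=> suppp m /suppp[m' Mm' le_m'].
  by have [m'' Mm'' le_m''] := subM _ Mm'; exists m'' => //; apply: lepm_trans le_m'.
have [m'' Mm'' le_m''] := (generated_byX _ _ _ genI).1 (subM' _ Mm').
by exists m'' => //; apply: lepm_trans le_m'.
Qed.

Lemma mingens_gen I m : mingens I m -> I 'X_[m].
Proof.
by case=> M [genI _] Mm; rewrite (generated_byX _ _ _ genI); exists m => //; apply: lepm_refl.
Qed.

(** If m' differed from [m], some generator other than [m] would divide [m], and the generators
    without [m] would still generate. *)
Lemma mingens_minimal I m m' : mingens I m -> I 'X_[m'] -> (m' <= m)%MM -> m' = m.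
Proof.
case=> M [genI minM] Mm Im' le_m'; case: (eqVneq m' m) => // neq_m'm.
have [m'' Mm'' le_m''] := (generated_byX _ _ _ genI).1 Im'.
have neq_m''m : m'' <> m.
  move=> def_m; case/eqP: neq_m'm; apply/mnmP => i; apply/eqP; rewrite eqn_leq.
  by move/mnm_lepP: le_m' => ->; move/mnm_lepP: le_m''; rewrite def_m => ->.
suff genM' : generated_by I (fun x => M x /\ x <> m).
  by have [|_ /(_ erefl)] := minM _ _ genM' m Mm; first by move=> ? [].
apply: (generated_by_sub _ _ _ genI) => [x [Mx _]|x Mx].
  by rewrite (generated_byX _ _ _ genI); exists x => //; apply: lepm_refl.
case: (eqVneq x m) => [->|/eqP neq_xm]; last by exists x => //; apply: lepm_refl.
by exists m'' => //; apply: lepm_trans le_m'' le_m'.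
Qed.

(** Descent on the degree; minimality is decided classically since [P] is an arbitrary
    proposition. *)
Lemma minimal_divisor (P : 'X_{1..n} -> Prop) m : P m ->
  exists2 m0, P m0 /\ (forall m', P m' -> (m' <= m0)%MM -> m' = m0) & (m0 <= m)%MM.
Proof.
have [d] := ubnP (mdeg m); elim: d m => // d IHd m le_md Pm.
have [min_m | ] := classic (forall m', P m' -> (m' <= m)%MM -> m' = m).
  by exists m => //; apply: lepm_refl.
move=> /not_all_ex_not[m' nmin]; have [Pm' {}nmin] := imply_to_and _ _ nmin.
have [le_m' /eqP neq_m'] := imply_to_and _ _ nmin.
have [|m0 Pm0 le_m0] := IHd m' _ Pm'; last by exists m0 => //; apply: lepm_trans le_m'.
have := submK le_m' => def_m.
have : mdeg (m - m')%MM != 0%N.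
  by apply: contra neq_m'; rewrite mdeg_eq0 -{2}def_m => /eqP->; rewrite add0m.
by have := mdegD (m - m')%MM m'; rewrite def_m; lia.
Qed.

(** The set [M0] of all divisibility-minimal monomials of [I] generates, and each of them lies in
    every generating subset, as only itself can divide it. *)
Lemma minimal_mingens I M m : generated_by I M -> I 'X_[m] ->
  (forall m', I 'X_[m'] -> (m' <= m)%MM -> m' = m) -> mingens I m.
Proof.
move=> genI Im min_m.
pose M0 x := I 'X_[x] /\ forall m', I 'X_[m'] -> (m' <= x)%MM -> m' = x.
exists M0 => //; split=> [|M' subM' genM' x [Ix min_x]].
  apply: (generated_by_sub _ _ _ genI) => [x []|x Mx] //.
  apply: (minimal_divisor (fun x => I 'X_[x])).
  by rewrite (generated_byX _ _ _ genI); exists x => //; apply: lepm_refl.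
have [y M'y le_yx] := (generated_byX _ _ _ genM').1 Ix.
by rewrite -(min_x y) //; case: (subM' _ M'y).
Qed.

Lemma mingens_below I M m : generated_by I M -> I 'X_[m] ->
  exists2 m0, mingens I m0 & (m0 <= m)%MM.
Proof.
move=> genI /(minimal_divisor (fun x => I 'X_[x]))[m0 [Im0 min_m0] le_m0].
by exists m0 => //; apply: minimal_mingens genI Im0 min_m0.
Qed.

(** Extends the exchange from minimal generators to all monomials of [J]: for a minimal generator
    [w0] dividing [w], either x_j does not divide [w0] and [w0] divides the exchanged monomial, or
    the exchange of [w0] does. *)
Lemma strongly_stable_exchange t J (w : 'X_{1..n}) (i j : 'I_n) : (0 < t)%N ->
  t_spread_strongly_stable t J -> J 'X_[w] -> (i < j)%N -> (0 < w j)%N ->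
  t_spread t (mnm_exchange w i j) -> J 'X_[mnm_exchange w i j].
Proof.
move=> t_gt0 [[M _ genJ] stJ] Jw lt_ij wj spread.
have [w0 gen_w0 /mnm_lepP le_w0] := mingens_below _ _ _ genJ Jw.
have [w0j | w0j] := posnP (w0 j).
  apply: (generated_by_lepm _ _ w0 _ genJ (mingens_gen _ _ gen_w0)).
  apply/mnm_lepP => k; rewrite /mnm_exchange mnmDE mnmBE !mnm1E.
  have := le_w0 k; case: (eqVneq j k) => [<-|_]; lia.
have le_ex : (mnm_exchange w0 i j <= mnm_exchange w i j)%MM.
  by apply/mnm_lepP => k; rewrite /mnm_exchange !mnmDE !mnmBE; have := le_w0 k; lia.
apply: (generated_by_lepm _ _ _ _ genJ _ le_ex); apply: stJ => //.
exact: t_spread_lep t_gt0 le_ex spread.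
Qed.

End MonomialIdeals.

(** * The generators of B_t(u) *)

(** In equal degrees, F_u <= F_m says that the k-th index of [m] is at most the k-th index of [u],
    that is j_k <= i_k. *)
Definition borel_set (t : nat) {n : nat} (u m : 'X_{1..n}) : Prop :=
  [/\ t_spread t m, mdeg m = mdeg u & forall c, cumdeg u c <= cumdeg m c].

Lemma borel_set_exchange t n (u w : 'X_{1..n}) (i j : 'I_n) :
  borel_set t u w -> i < j -> 0 < w j -> t_spread t (mnm_exchange w i j) ->
  borel_set t u (mnm_exchange w i j).
Proof.
move=> [_ deg_w le_w] lt_ij wj spread; split=> // [|c]; first by rewrite mdeg_exchange.
by have := cumdeg_exchange _ w i j c wj; have := le_w c; lia.
Qed.

Lemma borel_set_sort t n (u v w : 'X_{1..n}) : 0 < t ->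
  borel_set t u v -> borel_set t u w ->
  borel_set t u (mnm_sort v w).1 /\ borel_set t u (mnm_sort v w).2.
Proof.
move=> t_gt0 [/t_spreadP sv dv le_v] [/t_spreadP sw dw le_w].
have cum c := cumdeg_sort _ v w c.
split; split.
- apply/t_spreadP => // c; have := sv t_gt0 c; have := sw t_gt0 c.
  by rewrite (cum c).1 (cum _).1; lia.
- by rewrite -(cumdeg_mdeg _ _ n) // (cum n).1 !cumdeg_mdeg //; lia.
- by move=> c; rewrite (cum c).1; have := le_v c; have := le_w c; lia.
- apply/t_spreadP => // c; have := sv t_gt0 c; have := sw t_gt0 c.
  by rewrite (cum c).2 (cum _).2; lia.
- by rewrite -(cumdeg_mdeg _ _ n) // (cum n).2 !cumdeg_mdeg //; lia.
- by move=> c; rewrite (cum c).2; have := le_v c; have := le_w c; lia.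
Qed.

Lemma borel_set_lepm t n (u m1 m2 : 'X_{1..n}) :
  borel_set t u m1 -> borel_set t u m2 -> (m1 <= m2)%MM -> m1 = m2.
Proof.
move=> [_ d1 _] [_ d2 _] /submK def_m2; move: d2; rewrite -def_m2 mdegD d1.
move=> /(canRL (addnK _)); rewrite subnn => /eqP.
by rewrite mdeg_eq0 => /eqP->; rewrite add0m.
Qed.

(* Move the entries of w into place from left to right, one exchange at a time:
   q is the first index at which the cumulative degrees of w and m disagree. *)
Lemma borel_set_reachable (K : fieldType) t n (w m : 'X_{1..n})
    (J : {mpoly K[n]} -> Prop) : 0 < t ->
  t_spread_strongly_stable t J -> J 'X_[w]%R -> t_spread t w ->
  borel_set t w m -> J 'X_[m]%R.
Proof.
move=> t_gt0 stJ.
(* Induction on the total deficit of F_w below F_m. *)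
have [k] := ubnP (\sum_(c < n.+1) (cumdeg m c - cumdeg w c)).
elim: k w => // k IHk w lt_k Jw spread_w [spread_m deg_m le_wm].
have [/existsP[q0 lt_q0] | /existsPn eq_wm] :=
    boolP [exists q : 'I_n, cumdeg w q.+1 < cumdeg m q.+1]; last first.
  suff -> : m = w by [].
  apply: cumdeg_inj => c; apply/eqP; rewrite eqn_leq le_wm andbT.
  have [lt_cn|le_nc] := ltnP c n; last by rewrite !cumdeg_mdeg ?deg_m.
  case: c lt_cn => [|c] lt_cn; first by rewrite cumdeg0.
  by have := eq_wm (Ordinal (ltnW lt_cn)); rewrite -leqNgt.
have [q lt_q min_q] := arg_minnP (P := fun q : 'I_n => cumdeg w q.+1 < cumdeg m q.+1)
  (fun q => q : nat) lt_q0.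
have eq_q c : c <= q -> cumdeg w c = cumdeg m c.
  case: c => [|c] lt_cq; first by rewrite !cumdeg0.
  apply/eqP; rewrite eqn_leq le_wm leqNgt; apply/negP => lt_c.
  have := min_q (Ordinal (ltn_trans lt_cq (ltn_ord q))) lt_c.
  by rewrite /= leqNgt lt_cq.
(* As [m] is t-spread, F_w(q+1) < F_m(q+1) <= F_m(q+1-t) + 1 = F_w(q+1-t) + 1. *)
have gap : cumdeg w q.+1 <= cumdeg w (q.+1 - t).
  have := elimT (t_spreadP _ _ _ t_gt0) spread_m (q.+1 - t).
  have := leq_cumdeg _ m q.+1 (q.+1 - t + t).
  by rewrite (eq_q (q.+1 - t)); lia.
have lt_deg : cumdeg w q.+1 < mdeg w.
  by rewrite -deg_m; apply: leq_trans lt_q (cumdeg_le_mdeg _ _ _).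
have [j [lt_qj wj cum_j spread_w']] := t_spread_exchange _ _ _ _ t_gt0 spread_w gap lt_deg.
have cum_w' c := cumdeg_exchange _ w q j c wj.
(* For q < c <= j, F_w is constant and below F_m(q+1), so there is room for the added 1. *)
have le_w'm c : cumdeg (mnm_exchange w q j) c <= cumdeg m c.
  have := cum_w' c; have := le_wm c.
  have [lt_qc|] := ltnP q c; last by lia.
  have [|le_cj] := ltnP j c; first by lia.
  by have := leq_cumdeg _ w _ _ le_cj; have := leq_cumdeg _ m _ _ lt_qc; lia.
apply: (IHk (mnm_exchange w q j)) => //.
- rewrite -ltnS; apply: leq_trans lt_k; rewrite ltnS.
  (* [lift ord0 q] is the index q+1, where the deficit drops; no other term grows. *)
  rewrite [X in X < _](bigD1 (lift ord0 q)) // [X in _ < X](bigD1 (lift ord0 q)) //=.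
  rewrite -addSn leq_add ?leq_sum // => [|c _].
    by have := cum_w' q.+1; rewrite /bump leq0n add1n /=; lia.
  by have := cum_w' c; lia.
- exact: (strongly_stable_exchange _ _ t).
- by split=> //; rewrite mdeg_exchange.
Qed.

Section BorelIdeal.
Variables (K : fieldType) (t n : nat) (u : 'X_{1..n}).
Hypotheses (t_gt0 : 0 < t) (spread_u : t_spread t u).

Lemma borel_set_stable :
  t_spread_strongly_stable t (@monomial_ideal_gen K n (borel_set t u)).
Proof.
have genM : generated_by (@monomial_ideal_gen K n (borel_set t u)) (borel_set t u) by [].
split=> [|w i j gen_w lt_ij wj spread]; first by exists (borel_set t u) => // m [].
apply/monomial_ideal_genX.
have [w' Bw' le_w'] := (monomial_ideal_genX _ _ _ _).1 (mingens_gen _ _ _ _ gen_w).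
have def_w : w' = w.
  apply: (mingens_minimal _ _ _ _ _ gen_w) => //.
  by apply/monomial_ideal_genX; exists w' => //; apply: lepm_refl.
exists (mnm_exchange w i j); last exact: lepm_refl.
by apply: borel_set_exchange => //; rewrite -def_w.
Qed.

(** The ideal generated by [borel_set t u] is itself strongly stable and contains [u]; conversely,
    every such ideal contains [borel_set t u] by reachability. *)
Lemma t_spread_borel_generated : generated_by (@t_spread_borel K t n u) (borel_set t u).
Proof.
move=> p; split=> [Bp | genp J stJ Ju].
  apply: Bp borel_set_stable _; apply/monomial_ideal_genX.
  by exists u; [split | apply: lepm_refl].
have [[M _ genJ] _] := stJ; apply/genJ; apply: genp.
  exact: monomial_ideal_gen_ideal.
by move=> _ [m Bm ->]; apply/genJ; apply: (borel_set_reachable _ t _ u).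
Qed.

(** All elements of [borel_set t u] have the same degree, so none properly divides another. *)
Lemma mingens_t_spread_borel m : mingens (@t_spread_borel K t n u) m <-> borel_set t u m.
Proof.
have genB := t_spread_borel_generated.
have BX x : borel_set t u x -> t_spread_borel t u ('X_[x] : {mpoly K[n]}).
  by move=> Bx; apply/(generated_byX _ _ _ _ _ genB); exists x => //; apply: lepm_refl.
split=> [gen_m | Bm].
  have [x Bx le_x] := (generated_byX _ _ _ _ _ genB).1 (mingens_gen _ _ _ _ gen_m).
  by rewrite -(mingens_minimal _ _ _ _ _ gen_m (BX _ Bx) le_x).
apply: (minimal_mingens _ _ _ _ _ genB (BX _ Bm)) => x.
move=> /(generated_byX _ _ _ _ _ genB)[y By le_y] le_x.
have def_y := borel_set_lepm _ _ _ _ _ By Bm (lepm_trans le_y le_x); subst y.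
apply/mnmP => i; apply/eqP; rewrite eqn_leq.
by rewrite (mnm_lepP le_x) (mnm_lepP le_y).
Qed.

End BorelIdeal.

(** * Standard monomials and the exchange property *)

(** A nonzero sorting relation on two factors would have its initial monomial dividing the standard
    monomial. So the relation vanishes, the two factors are their own sorting up to order, and their
    cumulative degrees are the two roundings of one average. *)
Lemma standard_cumdeg_close (K : fieldType) (n t : nat) (u : 'X_{1..n}) (r : nat)
    (g : r.-tuple 'X_{1..n}) (le_sort : rel 'X_{1..r}) (N : nat)
    (us : N.-tuple 'I_r) :
  0 < t -> (forall m, m \in g <-> borel_set t u m) -> sorting_order K g le_sort ->
  standard_monomial le_sort (@toric_ideal K n r g) (\sum_(k < N) U_(tnth us k))%MM ->
  forall (k l : 'I_N) c,
    cumdeg (tnth g (tnth us k)) c <= (cumdeg (tnth g (tnth us l)) c).+1.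
Proof.
move=> t_gt0 g_borel [_ [gbP _] initP] std k l c.
case: (eqVneq k l) => [->|neq_kl]; first exact: leqnSn.
set a := tnth us k; set b := tnth us l.
have Bg x : borel_set t u (tnth g x) by apply/g_borel; apply: mem_tnth.
have [/g_borel/tnthP[a' def_a'] /g_borel/tnthP[b' def_b']] :=
  borel_set_sort _ _ _ _ _ t_gt0 (Bg a) (Bg b).
pose f : {mpoly K[r]} := ('X_a * 'X_b - 'X_a' * 'X_b')%R.
have rel_f : sorting_relation g a b f.
  by exists a', b'; split; rewrite // -def_a' -def_b'; case: mnm_sort.
have [cum_a' cum_b'] := cumdeg_sort _ (tnth g a) (tnth g b) c.
rewrite def_a' in cum_a'; rewrite def_b' in cum_b'.
case: (eqVneq f 0%R) => [f0 | nz_f]; last first.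
  case: std; apply/monomial_ideal_genX; exists (U_(a) + U_(b))%MM.
    exists f; last exact: initP rel_f nz_f.
    by apply: (gbP f _).1; split=> //; exists a, b.
  rewrite (bigD1 k) //= (bigD1 l) 1?eq_sym //= addmA.
  exact: lem_addr.
have : (U_(a) + U_(b) = U_(a') + U_(b'))%MM.
  move/eqP: f0; rewrite GRing.subr_eq0 -!mpolyXD => /eqP/(congr1 (@msupp _ _)).
  by rewrite !msuppX => /(congr1 (head 0%MM)).
move/mnmP => eq_ab.
have inab x : (a == x) || (b == x) -> (a' == x) || (b' == x).
  have := eq_ab x; rewrite !mnmDE !mnm1E.
  by case: (a == x); case: (b == x); case: (a' == x); case: (b' == x).
have := inab b; have := inab a; rewrite !eqxx orbT => /(_ isT) a_in /(_ isT) b_in.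
have sort_le x : (a' == x) || (b' == x) ->
    (cumdeg (tnth g a) c + cumdeg (tnth g b) c)./2 <= cumdeg (tnth g x) c
    <= uphalf (cumdeg (tnth g a) c + cumdeg (tnth g b) c).
  by case/orP => /eqP <-; rewrite ?cum_a' ?cum_b'; lia.
have /andP[_] := sort_le a a_in; have /andP[+ _] := sort_le b b_in; clear; lia.
Qed.

Theorem proposition2p2 (K : fieldType) (n t : nat) (u : 'X_{1..n}) (r : nat)
    (g : r.-tuple 'X_{1..n}) (le_sort : rel 'X_{1..r}) :
  1 <= t ->
  t_spread t u ->
  enumerates_mingens (@t_spread_borel K t n u) g ->
  sorting_order K g le_sort ->
  l_exchange (@t_spread_borel K t n u) g le_sort.
Proof.
move=> t_gt0 spread_u [_ g_mingens] sortP N us vs q std_us _ _ eq_lt_q lt_q.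
have g_borel m : m \in g <-> borel_set t u m.
  by rewrite g_mingens; apply: mingens_t_spread_borel.
have Bg x : borel_set t u (tnth g x) by apply/g_borel; apply: mem_tnth.
pose F (s : N.-tuple 'I_r) k c := cumdeg (tnth g (tnth s k)) c.
have close k l c : F us k c <= (F us l c).+1.
  exact: (standard_cumdeg_close _ _ _ _ _ _ _ _ _ t_gt0 g_borel sortP std_us).
(* Condition (i) gives equal sums of cumulative degrees up to q; with (ii) they differ strictly at
   q+1. *)
have cum_eq c : c <= q -> \sum_k F us k c = \sum_k F vs k c.
  move=> le_cq; rewrite -!cumdeg_sum; apply: eq_bigr => i lt_ic.
  exact: eq_lt_q (leq_trans lt_ic le_cq).
have cum_lt : \sum_k F us k q.+1 < \sum_k F vs k q.+1.
  by rewrite -!cumdeg_sum !cumdegS !cumdeg_sum cum_eq // ltn_add2l.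
set c0 := q.+1 - t.
have cum_vs k : F vs k q.+1 <= (F vs k c0).+1.
  have [/t_spreadP spread _ _] := Bg (tnth vs k).
  by apply: leq_trans (spread t_gt0 c0); apply: leq_cumdeg; lia.
have [delta gap lt_deg] : exists2 delta, F us delta q.+1 <= F us delta c0
                                       & F us delta q.+1 < mdeg u.
  have le_deg k c : F vs k c <= mdeg u.
    by have [_ <- _] := Bg (tnth vs k); apply: cumdeg_le_mdeg.
  have [/existsP[delta /andP[]] | /existsPn none] :=
      boolP [exists k, (F us k q.+1 <= F us k c0) && (F us k q.+1 < mdeg u)].
    by exists delta.
  (* If one factor has full degree d at [c0], closeness gives F(c0) >= d - 1 for all; as no factor
     qualifies, each then has F(q+1) >= d. *)
  have [/existsP[k0 full0] | /existsPn gap] := boolP [exists k, mdeg u <= F us k c0].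
    have : \sum_k F vs k q.+1 <= \sum_k F us k q.+1.
      apply: leq_sum => k _; apply: leq_trans (le_deg _ _) _.
      have := none k; have := close k0 k c0; lia.
    by rewrite leqNgt cum_lt.
  (* Now every factor has F(c0) < d, so failing to qualify forces F(q+1) >= F(c0) + 1 in either
     case; the sums at [c0] agree because t >= 1 gives c0 <= q. *)
  have : \sum_k F vs k q.+1 <= \sum_k F us k q.+1.
    apply: (@leq_trans (\sum_k (F vs k c0 + 1))).
      by apply: leq_sum => k _; rewrite addn1.
    rewrite big_split /= -cum_eq; last by rewrite /c0; lia.
    rewrite -big_split; apply: leq_sum => k _ /=; have := none k; have := gap k; lia.
  by rewrite leqNgt cum_lt.
have Bd := Bg (tnth us delta); have [spread_d deg_d _] := Bd.
rewrite -deg_d in lt_deg.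
have [j [lt_qj dj _ spread_j]] := t_spread_exchange _ _ _ _ t_gt0 spread_d gap lt_deg.
exists delta, j; split=> //.
apply: mingens_gen; apply/mingens_t_spread_borel => //.
exact: borel_set_exchange.
Qed.
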